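(* 1. The groups $P_{(34)}\mathcal{X}_3$, $P_{(24)}\mathcal{Y}_3$ and $P_{(23)}\mathcal{Z}_3$ (under matrix multiplication) are commutative, and every matrix $A$ in any of these groups can be written as $A=xI+yP+zP^2+wP^3$ for some $x,y,z,w\in\mathbb{C}$, where $P=P_{(1324)}$ if $A\in P_{(34)}\mathcal{X}_3$, $P=P_{(1234)}$ if $A\in P_{(24)}\mathcal{Y}_3$, and $P=P_{(1342)}$ if $A\in P_{(23)}\mathcal{Z}_3$. 2. The set $\mathcal{OP}_4$ is not closed under matrix multiplication, and hence does not form a group.
   Context: $\mathcal{OP}_4$ is the set of complex $4\times4$ matrices $A$ with $A^TA=I$ that are permutative (each row is a permutation of any other row). For a permutation $\sigma$, $P_\sigma$ is the permutation matrix with $(i,j)$ entry $1$ if $\sigma(i)=j$ and $0$ otherwise. For a matrix $P$ and a set $\mathcal{S}$ of matrices, $P\mathcal{S}=\{PD:D\in\mathcal{S}\}$. For complex $t,x,z$: $$A_t=\begin{bmatrix}t&-t\\-t&t\end{bmatrix},\quad B^{+}_t=\begin{bmatrix}t&1-t\\ 1-t&t\end{bmatrix},\quad F=\begin{bmatrix}0&1\\1&0\end{bmatrix},\quad N^{+}_{x,z}=\begin{bmatrix}B^{+}_x&A_z\\ A_z&FB^{+}_x\end{bmatrix}.$$ $\mathcal{X}_3=\{N^+_{x,z}:x,z\in\mathbb{C},\ x^2+z^2-x=0\}$, $\mathcal{Y}_3=\{P_{(23)}DP_{(23)}:D\in\mathcal{X}_3\}$, $\mathcal{Z}_3=\{P_{(24)}DP_{(24)}:D\in\mathcal{X}_3\}$.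 *)

(* Defs.v *)
From mathcomp Require Import all_boot all_order all_fingroup all_algebra.
From mathcomp Require Import classical_sets reals.
From mathcomp Require Import complex.

Set Implicit Arguments.
Unset Strict Implicit.
Unset Printing Implicit Defensive.

Import GRing.Theory.
Local Open Scope classical_set_scope.
Local Open Scope ring_scope.

(* The indices 1, 2, 3, 4 are encoded by the ordinals 0, 1, 2, 3 of 'I_4. *)
Definition p1 : 'I_4 := @Ordinal 4 0 isT.
Definition p2 : 'I_4 := @Ordinal 4 1 isT.
Definition p3 : 'I_4 := @Ordinal 4 2 isT.
Definition p4 : 'I_4 := @Ordinal 4 3 isT.

(* The cycle (s_1 s_2 ... s_k): it sends s_i to s_{i+1}, s_k to s_1, and fixes
   every point outside s. *)
Definition cycle_perm (T : finType) (s : seq T) (Us : uniq s) : {perm T} :=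
  perm (can_inj (prev_next Us)).

Definition c23 : 'S_4 := @cycle_perm _ [:: p2; p3] isT.
Definition c24 : 'S_4 := @cycle_perm _ [:: p2; p4] isT.
Definition c34 : 'S_4 := @cycle_perm _ [:: p3; p4] isT.
Definition c1324 : 'S_4 := @cycle_perm _ [:: p1; p3; p2; p4] isT.
Definition c1234 : 'S_4 := @cycle_perm _ [:: p1; p2; p3; p4] isT.
Definition c1342 : 'S_4 := @cycle_perm _ [:: p1; p3; p4; p2] isT.

Section Matrices.
Variable R : realType.
Local Notation C := R[i].

Definition permutative n (A : 'M[C]_n) : Prop :=
  forall i j : 'I_n, exists s : 'S_n, row i A = col_perm s (row j A).

(* Complex orthogonality: plain transpose, no conjugation. *)
Definition OP4 : set 'M[C]_4 :=
  [set A | A^T *m A = 1%:M /\ permutative A].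

(* perm_mx s is the matrix whose (i, j) entry is 1 if s i = j and 0 otherwise. *)
Definition Pmx (s : 'S_4) : 'M[C]_4 := perm_mx s.

Definition Amx (t : C) : 'M[C]_2 := \matrix_(i, j) (if i == j then t else - t).

Definition Bplus (t : C) : 'M[C]_2 :=
  \matrix_(i, j) (if i == j then t else 1 - t).

Definition Fmx : 'M[C]_2 := \matrix_(i, j) (if i == j then 0 else 1).

Definition Nplus (x z : C) : 'M[C]_4 :=
  block_mx (Bplus x) (Amx z)
           (Amx z)   (Fmx *m Bplus x).

Definition X3 : set 'M[C]_4 :=
  [set A | exists x z : C, x ^+ 2 + z ^+ 2 - x = 0 /\ A = Nplus x z].

Definition Y3 : set 'M[C]_4 := [set Pmx c23 *m D *m Pmx c23 | D in X3].

Definition Z3 : set 'M[C]_4 := [set Pmx c24 *m D *m Pmx c24 | D in X3].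

Definition lmul_set n (P : 'M[C]_n) (S : set 'M[C]_n) : set 'M[C]_n :=
  [set P *m D | D in S].

Definition mulmx_closed n (S : set 'M[C]_n) : Prop :=
  forall A B, S A -> S B -> S (A *m B).

(* The neutral element is not required in advance to be the identity matrix.
   Associativity is inherited from *m. *)
Definition is_mulmx_group n (S : set 'M[C]_n) : Prop :=
  mulmx_closed S /\
  exists E, S E /\
    (forall A, S A -> E *m A = A /\ A *m E = A) /\
    (forall A, S A -> exists B, S B /\ A *m B = E /\ B *m A = E).

Definition is_comm_mulmx_group n (S : set 'M[C]_n) : Prop :=
  is_mulmx_group S /\ forall A B, S A -> S B -> A *m B = B *m A.

End Matrices.

Arguments OP4 R : clear implicits.
Arguments X3 R : clear implicits.
Arguments Y3 R : clear implicits.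
Arguments Z3 R : clear implicits.

(* Main.v *)
Require Import Defs.
From mathcomp Require Import all_boot all_order all_fingroup all_algebra.
From mathcomp Require Import classical_sets reals.
From mathcomp Require Import complex ring.

Set Implicit Arguments.
Unset Strict Implicit.
Unset Printing Implicit Defensive.

Import GRing.Theory Num.Theory.

Local Open Scope ring_scope.

(** Up to the conjugations by (23) and (24), each of the three sets consists of
the matrices p(Q) with p = x + z X + (1 - x) X^2 - z X^3 and x^2 + z^2 = x,
where Q is the permutation matrix of a 4-cycle.  Such polynomials are stable
under multiplication modulo X^4 - 1, and Q^T = Q^3 makes transposition act as
z |-> - z, which gives inverses; everything commutes because all elements are
polynomials in Q.  The elements for (x, z) = (4/5, 2/5) of the groups of (1324)
and (1234) are in OP_4, but 18/25 is an entry of the first row of their product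
and not of the second. *)

(** * Polynomials in the matrix of a permutation of order dividing 4 *)

Section Circulants.
Variable F : comNzRingType.
Implicit Types (x z : F) (s t : 'S_4).

Lemma perm_mxX n (s : 'S_n.+1) k :
  perm_mx s ^+ k = perm_mx (s ^+ k)%g :> 'M[F]_n.+1.
Proof.
elim: k => [|k IHk]; first by rewrite expr0 expg0 perm_mx1.
by rewrite exprS IHk expgS perm_mxM.
Qed.

Definition circ_poly x z : {poly F} :=
  x%:P + z%:P * 'X + (1 - x)%:P * 'X^2 - z%:P * 'X^3.

Definition circ s x z : 'M[F]_4 := horner_mx (perm_mx s) (circ_poly x z).

Lemma circ_perm_mx s x z :
  circ s x z = x%:M + z *: perm_mx s + (1 - x) *: perm_mx (s ^+ 2)%g
               - z *: perm_mx (s ^+ 3)%g.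
Proof.
have hX (a : F) k : horner_mx (perm_mx s) (a%:P * 'X^k) = a *: perm_mx (s ^+ k)%g.
  by rewrite rmorphM rmorphXn /= horner_mx_C horner_mx_X perm_mxX -mul_scalar_mx.
(* ['X] is exchanged for the convertible ['X^1], so that [hX] covers all three monomials. *)
by rewrite /circ /circ_poly raddfB 2!raddfD /= -[z%:P * 'X]/(z%:P * 'X^1) !hX horner_mx_C.
Qed.

Lemma circE s x z i j :
  circ s x z i j = x *+ (i == j) + z *+ (s i == j)
                   + (1 - x) *+ (s (s i) == j) - z *+ (s (s (s i)) == j).
Proof.
by rewrite circ_perm_mx !mxE !permM !mulr_natr.
Qed.

Lemma circC s x z x' z' : circ s x z *m circ s x' z' = circ s x' z' *m circ s x z.
Proof. exact: comm_horner_mx2. Qed.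

Lemma circ1 s : circ s 1 0 = 1%:M.
Proof. by rewrite circ_perm_mx subrr !scale0r subr0 !addr0. Qed.

(** In the coordinates u = 2x - 1, v = 2z, this is the multiplication of complex numbers u + iv: the
    polynomial takes the value 1 at 1 and -1, and u + iv at i. *)
Lemma circM s x z x' z' : (s ^+ 4 = 1)%g ->
  circ s x z *m circ s x' z' =
  circ s (x * x' + (1 - x) * (1 - x') - 2 * z * z')
         ((2 * x - 1) * z' + (2 * x' - 1) * z).
Proof.
move=> s4; rewrite /circ mulmxE -rmorphM.
have X4 : horner_mx (perm_mx s : 'M[F]_4) ('X^4 - 1) = 0.
  by rewrite rmorphB rmorphXn /= rmorph1 horner_mx_X perm_mxX s4 perm_mx1 subrr.
(* The cofactor of ['X^4 - 1] consists of the terms of degree 4 to 6 of the product, divided by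
   ['X^4]. *)
have -> : circ_poly x z * circ_poly x' z' =
    circ_poly (x * x' + (1 - x) * (1 - x') - 2 * z * z')
              ((2 * x - 1) * z' + (2 * x' - 1) * z)
    + (((1 - x) * (1 - x') - 2 * z * z')%:P
       - ((1 - x) * z' + (1 - x') * z)%:P * 'X + (z * z')%:P * 'X^2)
      * ('X^4 - 1).
  rewrite /circ_poly !(polyCB, polyCD, polyCM, polyC1); ring.
by rewrite rmorphD [X in _ + X]rmorphM /= X4 mulr0 addr0.
Qed.

Lemma tr_circ s x z : (s ^+ 4 = 1)%g -> (circ s x z)^T = circ s x (- z).
Proof.
move=> s4; rewrite !circ_perm_mx !linearB /= !linearD /= !linearZ /=.
rewrite tr_scalar_mx !tr_perm_mx.
have -> : (s^-1 = s ^+ 3)%g by apply: (mulgI s); rewrite mulgV -expgS.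
have -> : (s ^+ 2)^-1%g = (s ^+ 2)%g by apply: (mulgI (s ^+ 2)%g); rewrite mulgV -expgD.
have -> : (s ^+ 3)^-1%g = s by apply: (mulgI (s ^+ 3)%g); rewrite mulgV -expgSr.
by rewrite !scaleNr !scalerN opprK addrAC [RHS]addrAC; congr (_ + _); exact: addrAC.
Qed.

Lemma circ_tr_mul s x z : (s ^+ 4 = 1)%g -> x ^+ 2 + z ^+ 2 - x = 0 ->
  (circ s x z)^T *m circ s x z = 1%:M.
Proof.
move=> s4 xz; rewrite tr_circ // circM // -(circ1 s); congr (circ s _ _); last ring.
(* The first parameter of the product is 1 + 2 (x^2 + z^2 - x). *)
by rewrite -[RHS]addr0 -(mulr0 2) -xz; ring.
Qed.

Lemma circJ s t x z :
  circ (s ^ t)%g x z *m perm_mx t^-1 = perm_mx t^-1 *m circ s x z.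
Proof.
rewrite !circ_perm_mx -!conjXg /conjg !(mulmxDl, mulmxDr, mulNmx, mulmxN).
rewrite -!scalemxAl -!scalemxAr mul_scalar_mx mul_mx_scalar.
by rewrite -!perm_mxM !mulgA !mulgK.
Qed.

End Circulants.

(** * Identities between permutations of four points *)

Lemma cycle_permE (T : finType) (s : seq T) (Us : uniq s) x :
  cycle_perm Us x = next s x.
Proof. by rewrite permE. Qed.

(** Passing to [val] leaves equalities of natural numbers, which compute at each of the four
    points. *)
Ltac perm4 :=
  let i := fresh in
  apply/permP=> i; rewrite /conjg !(permM, perm1, cycle_permE); apply: val_inj;
  by case: i => -[|[|[|[|]]]].

Lemma c1324_order : (c1324 ^+ 4 = 1)%g. Proof. perm4. Qed.
Lemma c1234_order : (c1234 ^+ 4 = 1)%g. Proof. perm4. Qed.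
Lemma c1342_order : (c1342 ^+ 4 = 1)%g. Proof. perm4. Qed.
Lemma c23K : (c23^-1 = c23)%g.
Proof. by apply: (mulgI c23); rewrite mulgV; perm4. Qed.
Lemma c24K : (c24^-1 = c24)%g.
Proof. by apply: (mulgI c24); rewrite mulgV; perm4. Qed.
Lemma c1324J23 : (c1324 ^ c23 = c1234)%g.
Proof. by rewrite /conjg c23K; perm4. Qed.
Lemma c1324J24 : (c1324 ^ c24 = c1342)%g.
Proof. by rewrite /conjg c24K; perm4. Qed.
(** This and the next identity move the left factor past the conjugating transposition, where it
    becomes (34). *)
Lemma c24M23 : (c24 * c23 = c23 * c34)%g. Proof. perm4. Qed.
Lemma c23M24 : (c23 * c24 = c24 * c34)%g. Proof. perm4. Qed.

(** * The three groups and their inclusion in the permutative orthogonal matrices *)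

Section Groups.
Variable R : realType.
Local Notation C := R[i].
Local Open Scope classical_set_scope.

Definition circ_group (s : 'S_4) : set 'M[C]_4 :=
  [set A | exists x z : C, x ^+ 2 + z ^+ 2 - x = 0 /\ A = circ s x z].

Lemma circ_group_comm s : (s ^+ 4 = 1)%g -> is_comm_mulmx_group (circ_group s).
Proof.
move=> s4; split; last first.
  by move=> _ _ [x [z [_ ->]]] [x' [z' [_ ->]]]; exact: circC.
split.
  move=> _ _ [x [z [xz ->]]] [x' [z' [xz' ->]]]; rewrite circM //.
  do 2 eexists; split; last by [].
  (* a multiplicative norm: (2x - 1)^2 + (2z)^2 = 1 + 4 (x^2 + z^2 - x) *)
  transitivity ((x ^+ 2 + z ^+ 2 - x) * (1 + 4 * (x' ^+ 2 + z' ^+ 2 - x'))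
                + (x' ^+ 2 + z' ^+ 2 - x')); first ring.
  by rewrite xz xz' mul0r addr0.
exists 1%:M; split; first by exists 1, 0; rewrite circ1; split => //; ring.
split=> [A _ | _ [x [z [xz ->]]]]; first by rewrite mul1mx mulmx1.
exists (circ s x (- z)); split.
  by exists x, (- z); rewrite sqrrN.
by rewrite circC -tr_circ // circ_tr_mul.
Qed.

Lemma circ_group_span s (A : 'M[C]_4) : circ_group s A ->
  exists x y z w : C,
    A = x *: 1%:M + y *: Pmx R s + z *: Pmx R s ^+ 2 + w *: Pmx R s ^+ 3.
Proof.
move=> [x [z [_ ->]]]; exists x, z, (1 - x), (- z).
by rewrite circ_perm_mx scalemx1 scaleNr /Pmx !perm_mxX.
Qed.

(** Since F^2 = 1 and F A_z = -A_z, swapping the last two rows gives the blocks B_x, A_z over -A_z,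
    B_x. The proof compares the 16 entries. *)
Lemma c34_Nplus (x z : C) : Pmx R c34 *m Nplus x z = circ c1324 x z.
Proof.
have F0 (f : 'I_2 -> C) : \sum_i f i = f ord0 + f (lift ord0 ord0).
  by rewrite !big_ord_recl big_ord0 addr0.
rewrite /Pmx -row_permE; apply/matrixP=> i j; rewrite circE !mxE !cycle_permE.
case: i => -[|[|[|[|]]]] //= ?; case: j => -[|[|[|[|]]]] //= ?;
  by do 2 (case: splitP => -[[|[|]]] //= ? _; rewrite !mxE); rewrite ?F0 ?mxE /=; ring.
Qed.

Lemma X3_circ : lmul_set (Pmx R c34) (X3 R) = circ_group c1324.
Proof.
apply/seteqP; split=> [_ [_ [x [z [xz ->]]] <-] | _ [x [z [xz ->]]]].
  by exists x, z; rewrite c34_Nplus.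
by exists (Nplus x z); [exists x, z | rewrite c34_Nplus].
Qed.

(** With t an involution, P_u (P_t D P_t) = P_t (P_(34) D) P_t is the conjugate by P_t of an element
    of the group of (1324). Both [Y3] and [Z3] are instances. *)
Lemma conj_circ (s t u : 'S_4) :
  (t^-1 = t)%g -> (u * t = t * c34)%g -> (c1324 ^ t = s)%g ->
  lmul_set (Pmx R u) [set Pmx R t *m D *m Pmx R t | D in X3 R] = circ_group s.
Proof.
move=> tK ut <-.
have E x z : Pmx R u *m (Pmx R t *m Nplus x z *m Pmx R t) = circ (c1324 ^ t)%g x z.
  rewrite /Pmx !mulmxA -perm_mxM ut perm_mxM -(mulmxA (perm_mx t)).
  rewrite [perm_mx c34 *m _]c34_Nplus -[in X in X *m _]tK -circJ -mulmxA -perm_mxM.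
  by rewrite mulVg perm_mx1 mulmx1.
apply/seteqP; split=> [_ [_ [_ [x [z [xz ->]]] <-] <-] | _ [x [z [xz ->]]]].
  by exists x, z; rewrite E.
exists (Pmx R t *m Nplus x z *m Pmx R t); last exact: E.
by exists (Nplus x z) => //; exists x, z.
Qed.

Lemma Y3_circ : lmul_set (Pmx R c24) (Y3 R) = circ_group c1234.
Proof. exact: conj_circ c23K c24M23 c1324J23. Qed.

Lemma Z3_circ : lmul_set (Pmx R c23) (Z3 R) = circ_group c1342.
Proof. exact: conj_circ c24K c23M24 c1324J24. Qed.

(* circ s x z commutes with the permutation matrix of s, so its rows s i and i
   differ by a permutation of the columns. *)
Lemma circ_permutative (s : 'S_4) (x z : C) :
  (forall i j, exists k, iter k s i = j) -> permutative (circ s x z).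
Proof.
move=> trs i j; have [k <-] := trs j i.
rewrite -permX; exists (s ^- k)%g; have /(congr1 (row j)) : perm_mx (s ^+ k)%g *m circ s x z
    = circ s x z *m perm_mx (s ^+ k)%g.
  by rewrite -perm_mxX; apply: comm_mx_horner; rewrite /comm_mx mulmxE -exprS -exprSr.
rewrite -row_permE -[(s ^+ k)%g in RHS]invgK -col_permE => E.
apply/rowP=> l; move/rowP/(_ l): E; by rewrite !mxE.
Qed.

Lemma circ_group_OP4 (s : 'S_4) : (s ^+ 4 = 1)%g ->
  (forall i j, exists k, iter k s i = j) -> circ_group s `<=` OP4 R.
Proof.
move=> s4 trs _ [x [z [xz ->]]]; split; first exact: circ_tr_mul.
exact: circ_permutative.
Qed.

End Groups.

(** * Failure of closure *)

Lemma cycle_perm_transitive (T : finType) (s : seq T) (Us : uniq s) i j :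
  i \in s -> j \in s -> exists k, iter k (cycle_perm Us) i = j.
Proof.
move=> si sj; exists (findex (next s) i j).
rewrite (eq_iter (cycle_permE Us)) iter_findex //.
by rewrite (fconnect_cycle (cycle_next Us)).
Qed.

Lemma c1324_transitive (i j : 'I_4) : exists k, iter k c1324 i = j.
Proof.
by apply: cycle_perm_transitive; [case: i | case: j] => -[|[|[|[|]]]].
Qed.

Lemma c1234_transitive (i j : 'I_4) : exists k, iter k c1234 i = j.
Proof.
by apply: cycle_perm_transitive; [case: i | case: j] => -[|[|[|[|]]]].
Qed.

Lemma OP4_not_closed (R : realType) : ~ mulmx_closed (OP4 R).
Proof.
move=> clo.
(* The rational point comes from 3^2 + 4^2 = 5^2, as (2x - 1, 2z) = (3/5, 4/5). *)
have xz : (4 / 5) ^+ 2 + (2 / 5) ^+ 2 - 4 / 5 = 0 :> R[i] by field.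
have A4 : OP4 R (circ c1324 (4 / 5) (2 / 5)).
  by apply: (circ_group_OP4 c1324_order c1324_transitive); do 2 eexists; split; first exact: xz.
have B4 : OP4 R (circ c1234 (4 / 5) (2 / 5)).
  by apply: (circ_group_OP4 c1234_order c1234_transitive); do 2 eexists; split; first exact: xz.
have [_ /(_ p1 p2) [s /rowP /(_ p3)]] := clo _ _ A4 B4.
rewrite !mxE !big_ord_recl !big_ord0 !circE !cycle_permE.
have neq0 n : (0 < n)%N -> n%:R / 25 <> 0 :> R[i].
  by move=> n0; apply/eqP; rewrite mulf_neq0 ?invr_eq0 ?pnatr_eq0 -?lt0n.
(* The second row of the product is (-2, 24, -3, 6) / 25; the numerators 20, 6, 21, 12 below are the
   distances of its entries from 18. *)
case: (s p3) => -[|[|[|[|]]]] //= ? /eqP; rewrite -subr_eq0 => /eqP E.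
- by apply: (neq0 20%N) => //; rewrite -E; field.
- by apply: (neq0 6%N) => //; rewrite -[RHS]oppr0 -E; field.
- by apply: (neq0 21%N) => //; rewrite -E; field.
- by apply: (neq0 12%N) => //; rewrite -E; field.
Qed.

Theorem mainTheorem5 (R : realType) :
  ( is_comm_mulmx_group (lmul_set (Pmx R c34) (X3 R)) /\
    is_comm_mulmx_group (lmul_set (Pmx R c24) (Y3 R)) /\
    is_comm_mulmx_group (lmul_set (Pmx R c23) (Z3 R)) /\
    (forall A : 'M[R[i]]_4, lmul_set (Pmx R c34) (X3 R) A ->
       exists x y z w : R[i],
         A = x *: 1%:M + y *: Pmx R c1324 + z *: Pmx R c1324 ^+ 2
             + w *: Pmx R c1324 ^+ 3) /\
    (forall A : 'M[R[i]]_4, lmul_set (Pmx R c24) (Y3 R) A ->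
       exists x y z w : R[i],
         A = x *: 1%:M + y *: Pmx R c1234 + z *: Pmx R c1234 ^+ 2
             + w *: Pmx R c1234 ^+ 3) /\
    (forall A : 'M[R[i]]_4, lmul_set (Pmx R c23) (Z3 R) A ->
       exists x y z w : R[i],
         A = x *: 1%:M + y *: Pmx R c1342 + z *: Pmx R c1342 ^+ 2
             + w *: Pmx R c1342 ^+ 3) ) /\
  ( ~ mulmx_closed (OP4 R) /\ ~ is_mulmx_group (OP4 R) ).
Proof.
rewrite X3_circ Y3_circ Z3_circ; split; last first.
  by split=> [clo | [clo _]]; exact: OP4_not_closed clo.
split; first exact: circ_group_comm c1324_order.
split; first exact: circ_group_comm c1234_order.
split; first exact: circ_group_comm c1342_order.
by split; [|split]; exact: circ_group_span.
Qed.
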